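(* Let $1\le p<\infty$ and $n\ge 2$. Then $U(n,p) \le U(n-1,p)\cdot w(n,p)$.
   Context: Let $q = 1/p$ (with $0^q=0$). For $n\ge 1$, $U(n,p)$ denotes the maximum of $\mathrm{per}(A)=\sum_{\sigma\in S_n}\prod_{i=1}^n a_{i\sigma(i)}$ over all real $n\times n$ matrices $A$ each of whose rows has $\ell_p$-norm equal to $1$. For $k\ge1$ let $\Delta_k=\{y\in\mathbb R^k: y_i\ge 0,\ \sum_i y_i=1\}$, and define $P_k(y) = \sum_{i=1}^k y_i^q \prod_{j\ne i}(1-y_j)^q$ for $y\in\Delta_k$. Then $w(k,p)=\max_{y\in\Delta_k} P_k(y)$. *)

(* Defs.v *)
From HB Require Import structures.
From mathcomp Require Import all_boot all_order all_algebra all_fingroup.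
From mathcomp Require Import all_classical all_reals all_analysis.
Unset Printing Implicit Defensive.
Import Order.TTheory GRing.Theory Num.Theory.
Local Open Scope ring_scope.
Local Open Scope classical_set_scope.

Section Defs.
Variable R : realType.

Definition perm_mx (n : nat) (A : 'M[R]_n) : R :=
  \sum_(s : 'S_n) \prod_(i < n) A i (s i).

Definition rows_lp_unit (p : R) (n : nat) (A : 'M[R]_n) : Prop :=
  forall i : 'I_n, (\sum_(j < n) `|A i j| `^ p) `^ p^-1 = 1.

(* U(n,p) = max of per(A) over such matrices (sup; the max is attained by compactness) *)
Definition U (n : nat) (p : R) : R :=
  sup [set @perm_mx n A | A in [set A : 'M[R]_n | @rows_lp_unit p n A]].

Definition simplex (k : nat) : set ('I_k -> R) :=
  [set y | (forall i, 0 <= y i) /\ \sum_(i < k) y i = 1].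

(* P_k(y) = sum_i y_i^q prod_{j<>i} (1 - y_j)^q, q = 1/p, powR has 0 `^ q = 0 for q > 0 *)
Definition Pk (k : nat) (p : R) (y : 'I_k -> R) : R :=
  \sum_(i < k) (y i `^ p^-1 * \prod_(j < k | j != i) (1 - y j) `^ p^-1).

Definition w (k : nat) (p : R) : R := sup [set @Pk k p y | y in simplex k].

End Defs.
Arguments U {R} n p.
Arguments w {R} k p.
Arguments Pk {R} k p y.
Arguments perm_mx {R} n A.
Arguments rows_lp_unit {R} p n A.
Arguments simplex {R} k.

(* Main.v *)
Require Import Defs.
From HB Require Import structures.
From mathcomp Require Import all_boot all_order all_algebra all_fingroup.
From mathcomp Require Import all_classical all_reals all_analysis.
From mathcomp Require Import ring lra.
Import Order.TTheory GRing.Theory Num.Theory.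
Import numFieldNormedType.Exports.
Set Implicit Arguments.
Unset Strict Implicit.
Unset Printing Implicit Defensive.
Local Open Scope ring_scope.

(* Expanding along the first column, per(A) = sum_j a_j1 per(A_j) with A_j the (j, 1) minor.
   The permanent is homogeneous in each row, so |per(A_j)| is at most U(n-1,p) times the
   product of the l_p-norms of the rows of A_j, which are the (1 - y_k)^(1/p) for k <> j, where
   y_k = |a_k1|^p.  Hence per(A) <= U(n-1,p) P_n(y) for a point y of the cube [0,1]^n.
   To reach the simplex, put x_i = y_i / (y_i + t (1 - y_i)), with t > 0 chosen by the
   intermediate value theorem so that sum_i x_i = 1.  For u_i = 1 + (t - 1) x_i one has
   x_i = y_i u_i / t and 1 - x_i = (1 - y_i) u_i, so every term of P_n gets multiplied by
   (prod_i u_i / t)^(1/p), which is >= 1 by the Weierstrass product inequality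
   prod_i (1 + (t - 1) x_i) >= 1 + (t - 1) sum_i x_i = t.  Degenerate points (a coordinate
   equal to 1, or at most one positive coordinate) satisfy P_n(y) <= 1 <= w(n,p). *)

Section Permanent.
Variable R : realType.

(* The signless analogue of [expand_cofactor] from matrix.v, with the same proof. *)
Lemma perm_mx_minor m (A : 'M[R]_m.+1) i0 j0 :
  Defs.perm_mx m (col' j0 (row' i0 A)) =
  \sum_(s : 'S_m.+1 | s i0 == j0) \prod_(k | i0 != k) A k (s k).
Proof.
rewrite (reindex (lift_perm i0 j0)); last first.
  pose ulsf i (s : 'S_m.+1) k := odflt k (unlift (s i) (s (lift i k))).
  have ulsfK i (s : 'S_m.+1) k : lift (s i) (ulsf i s k) = s (lift i k).
    rewrite /ulsf; have := neq_lift i k.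
    by rewrite -(can_eq (permK s)) => /unlift_some[] ? ? ->.
  have inj_ulsf : injective (ulsf i0 _).
    move=> s; apply: can_inj (ulsf (s i0) s^-1%g) _ => k'.
    by rewrite {1}/ulsf ulsfK !permK liftK.
  exists (fun s => perm (inj_ulsf s)) => [s _ | s].
    by apply/permP=> k'; rewrite permE /ulsf lift_perm_lift lift_perm_id liftK.
  move/(s _ =P _) => si0; apply/permP=> k.
  case: (unliftP i0 k) => [k'|] ->; rewrite ?lift_perm_id //.
  by rewrite lift_perm_lift -si0 permE ulsfK.
rewrite /Defs.perm_mx; apply: eq_big => [s | s _]; first by rewrite lift_perm_id eqxx.
case: (pickP 'I_m) => [k0 _ | n0]; last first.
  by rewrite !big1 // => [j /unlift_some[i] | i _]; have := n0 i.
rewrite (reindex (lift i0)).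
  by apply: eq_big => [k | k _] /=; rewrite ?neq_lift // !mxE lift_perm_lift.
exists (fun k => odflt k0 (unlift i0 k)) => k; first by rewrite liftK.
by case/unlift_some=> k' -> ->.
Qed.

Lemma perm_mx_expand_col m (A : 'M[R]_m.+1) c :
  Defs.perm_mx m.+1 A = \sum_j A j c * Defs.perm_mx m (col' c (row' j A)).
Proof.
rewrite {1}/Defs.perm_mx (partition_big (fun s : 'S_m.+1 => (s^-1)%g c) predT) //=.
apply: eq_bigr => j _; rewrite perm_mx_minor big_distrr /=.
apply: eq_big => [s | s /eqP sj].
  by apply/eqP/eqP => [<-|<-]; rewrite ?permKV ?permK.
have sjc : s j = c by rewrite -sj permKV.
rewrite (bigD1 j) //= sjc; congr (_ * _).
by apply: eq_bigl => i; rewrite eq_sym.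
Qed.

Lemma perm_mx_scale_rows m (d : 'I_m -> R) (A : 'M[R]_m) :
  Defs.perm_mx m (\matrix_(i, j) (d i * A i j)) = (\prod_i d i) * Defs.perm_mx m A.
Proof.
rewrite /Defs.perm_mx mulr_sumr; apply: eq_bigr => s _; rewrite -big_split /=.
by apply: eq_bigr => i _; rewrite mxE.
Qed.

Lemma perm_mx_ge0 m (A : 'M[R]_m) : (forall i j, 0 <= A i j) -> 0 <= Defs.perm_mx m A.
Proof. by move=> A0; apply: sumr_ge0 => s _; apply: prodr_ge0. Qed.

Lemma perm_mx_row0 m (A : 'M[R]_m) i : (forall j, A i j = 0) -> Defs.perm_mx m A = 0.
Proof. by move=> Ai0; apply: big1 => s _; rewrite (bigD1 i) //= Ai0 mul0r. Qed.

End Permanent.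

Section RowNorms.
Variables (R : realType) (p : R).
Hypothesis p_gt0 : 0 < p.

Definition row_lpnorm m (A : 'M[R]_m) i := (\sum_j `|A i j| `^ p) `^ p^-1.
Arguments row_lpnorm {m}.

Lemma row_lpnorm_ge0 m (A : 'M[R]_m) i : 0 <= row_lpnorm A i.
Proof. exact: powR_ge0. Qed.

Lemma powR_row_lpnorm m (A : 'M[R]_m) i :
  row_lpnorm A i `^ p = \sum_j `|A i j| `^ p.
Proof.
rewrite -powRrM mulVf ?powRr1 ?gt_eqF //.
by apply: sumr_ge0 => j _; apply: powR_ge0.
Qed.

Lemma row_lpnorm_eq0 m (A : 'M[R]_m) i : row_lpnorm A i = 0 -> forall j, A i j = 0.
Proof.
move=> /powR_eq0_eq0 /psumr_eq0P Ai0 j; apply/normr0_eq0/powR_eq0_eq0.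
by apply: Ai0 => // k _; apply: powR_ge0.
Qed.

Lemma row_lpnorm_scale m (d : 'I_m -> R) (A : 'M[R]_m) i :
  row_lpnorm (\matrix_(i, j) (d i * A i j)) i = `|d i| * row_lpnorm A i.
Proof.
rewrite /row_lpnorm; under eq_bigr do rewrite mxE normrM powRM //.
rewrite -mulr_sumr powRM ?powR_ge0 //; last by apply: sumr_ge0 => j _; apply: powR_ge0.
by rewrite -powRrM mulfV ?gt_eqF // powRr1.
Qed.

Lemma rows_lp_unit_sum m (A : 'M[R]_m) :
  rows_lp_unit p m A -> forall i, \sum_j `|A i j| `^ p = 1.
Proof. by move=> A1 i; rewrite -powR_row_lpnorm [row_lpnorm _ _]A1 powR1. Qed.

Lemma rows_lp_unit_norm_le1 m (A : 'M[R]_m) i j : rows_lp_unit p m A -> `|A i j| <= 1.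
Proof.
move=> /rows_lp_unit_sum/(_ i) A1; rewrite leNgt; apply/negP => Aij_gt1.
have : 1 `^ p < `|A i j| `^ p by rewrite gt0_ltr_powR ?nnegrE.
rewrite powR1 ltNge -A1 (bigD1 j) //= lerDl; apply/negP/negPn.
by apply: sumr_ge0 => k _; apply: powR_ge0.
Qed.

Lemma rows_lp_unit_1 m : rows_lp_unit p m 1%:M.
Proof.
move=> i; rewrite (bigD1 i) //= big1 => [|j ji].
  by rewrite addr0 mxE eqxx mulr1n normr1 !powR1.
by rewrite mxE eq_sym (negbTE ji) mulr0n normr0 powR0 ?gt_eqF.
Qed.

Lemma has_ubound_perm_mx_lp_unit m :
  has_ubound [set Defs.perm_mx m A | A in [set A | rows_lp_unit p m A]].
Proof.
exists #|{: 'S_m}|%:R => _ [A A1 <-]; apply: le_trans (ler_norm _) _.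
apply: le_trans (ler_norm_sum _ _ _) _; rewrite -sumr_const; apply: ler_sum => s _.
rewrite normr_prod; apply: prodr_ile1 => i _.
by rewrite normr_ge0 rows_lp_unit_norm_le1.
Qed.

Lemma U_ge0 m : 0 <= U m p.
Proof.
apply: le_trans (ub_le_sup (has_ubound_perm_mx_lp_unit m) _); last first.
  by exists 1%:M => //; apply: rows_lp_unit_1.
by apply: perm_mx_ge0 => i j; rewrite mxE ler0n.
Qed.

Lemma perm_mx_le_U m (A : 'M[R]_m.+1) :
  `|Defs.perm_mx _ A| <= U m.+1 p * \prod_i row_lpnorm A i.
Proof.
case: (pickP (fun i => row_lpnorm A i == 0)) => [i /eqP Ai0 | A_neq0].
  rewrite (perm_mx_row0 (row_lpnorm_eq0 Ai0)) normr0 (bigD1 i) //= Ai0.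
  by rewrite mul0r mulr0.
have A_gt0 i : 0 < row_lpnorm A i by rewrite lt_def A_neq0 row_lpnorm_ge0.
(* Scaling row i by 1 / row_lpnorm A i, and row 0 also by the sign of per(A), yields a
   competitor for U with permanent |per(A)| / prod_i row_lpnorm A i. *)
pose e : R := (-1) ^+ (Defs.perm_mx _ A < 0)%R.
pose g (i : 'I_m.+1) : R := if i == ord0 then e else 1.
pose B := \matrix_(i, j) (g i / row_lpnorm A i * A i j).
have B1 : rows_lp_unit p _ B.
  move=> i; change (row_lpnorm B i = 1).
  rewrite row_lpnorm_scale normrM normfV (gtr0_norm (A_gt0 i)) mulfVK ?gt_eqF //.
  by rewrite /g; case: eqP; rewrite ?normr_sign ?normr1.
have prod_g : \prod_i g i = e.
  by rewrite (bigD1 ord0) //= big1 ?mulr1 ?/g ?eqxx // => i /negbTE ->.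
have := ub_le_sup (has_ubound_perm_mx_lp_unit _) (ex_intro2 _ _ B B1 erefl).
rewrite perm_mx_scale_rows big_split /= prodfV prod_g mulrAC -normrEsign.
by rewrite ler_pdivrMr //; apply: prodr_gt0 => i _.
Qed.

End RowNorms.

Lemma weierstrass_ler_prod (R : realDomainType) (I : Type) (s : seq I) (x : I -> R) c :
  -1 <= c -> (forall i, 0 <= x i <= 1) ->
  1 + c * \sum_(i <- s) x i <= \prod_(i <- s) (1 + c * x i).
Proof.
move=> c_ge x01; elim: s => [|a s IHs]; first by rewrite !big_nil mulr0 addr0.
rewrite !big_cons; have /andP[xa_ge0 xa_le1] := x01 a.
have S_ge0 : 0 <= \sum_(i <- s) x i by apply: sumr_ge0 => i _; case/andP: (x01 i).
have fa_ge0 : 0 <= 1 + c * x a by nra.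
apply: le_trans (ler_wpM2l fa_ge0 IHs).
set S := \sum_(i <- s) x i.
have : 0 <= c ^+ 2 * (x a * S) by rewrite mulr_ge0 ?sqr_ge0 ?mulr_ge0.
nra.
Qed.

Lemma powR_prod (R : realType) (I : Type) (s : seq I) (P : pred I) (a : I -> R) r :
  (forall i, 0 <= a i) -> \prod_(i <- s | P i) a i `^ r = (\prod_(i <- s | P i) a i) `^ r.
Proof.
move=> a_ge0; suff [] : 0 <= \prod_(i <- s | P i) a i /\
    \prod_(i <- s | P i) a i `^ r = (\prod_(i <- s | P i) a i) `^ r by [].
apply: (big_rec2 (fun x y => 0 <= y /\ x = y `^ r)); first by rewrite powR1.
by move=> i x y _ [y_ge0 ->]; rewrite mulr_ge0 ?powRM.
Qed.

Lemma powR_le1 (R : realType) (a r : R) : 0 <= r -> 0 <= a <= 1 -> a `^ r <= 1.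
Proof.
by move=> r_ge0 /andP[a_ge0 a_le1]; have := ge0_ler_powR r_ge0 a_ge0 ler01 a_le1; rewrite powR1.
Qed.

Section SimplexPolynomial.
Variables (R : realType) (p : R).
Hypothesis p_gt0 : 0 < p.

Definition Pk_term k (y : 'I_k -> R) i :=
  y i `^ p^-1 * \prod_(j | j != i) (1 - y j) `^ p^-1.

Lemma PkE k (y : 'I_k -> R) : Pk k p y = \sum_i Pk_term y i.
Proof. by []. Qed.

Lemma Pk_term_ge0 k (y : 'I_k -> R) i : 0 <= Pk_term y i.
Proof. by rewrite mulr_ge0 ?powR_ge0 ?prodr_ge0 // => j _; apply: powR_ge0. Qed.

Lemma Pk_term_le1 k (y : 'I_k -> R) i : (forall j, 0 <= y j <= 1) -> Pk_term y i <= 1.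
Proof.
move=> y01; have q_ge0 : 0 <= p^-1 by rewrite invr_ge0 ltW.
apply: mulr_ile1; rewrite ?powR_ge0 ?powR_le1 ?prodr_ge0 //.
- by move=> j _; apply: powR_ge0.
- apply: prodr_ile1 => j _; rewrite powR_ge0 powR_le1 //.
  by case/andP: (y01 j) => y_ge0 y_le1; rewrite subr_ge0 y_le1 lerBlDr lerDl.
Qed.

Lemma simplex_le1 k (y : 'I_k -> R) : simplex k y -> forall i, 0 <= y i <= 1.
Proof.
move=> [y_ge0 y_sum] i; rewrite y_ge0 -y_sum (bigD1 i) //= lerDl.
by apply: sumr_ge0 => j _.
Qed.

Lemma has_ubound_Pk_simplex k : has_ubound [set Pk k p y | y in simplex k].
Proof.
exists (\sum_(i < k) 1) => _ [y /simplex_le1 y01 <-].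
by rewrite PkE; apply: ler_sum => i _; apply: Pk_term_le1.
Qed.

Lemma Pk_le_w_simplex k (y : 'I_k -> R) : simplex k y -> Pk k p y <= w k p.
Proof. by move=> y_simplex; apply: ub_le_sup; [apply: has_ubound_Pk_simplex | exists y]. Qed.

Lemma w_ge1 k : 1 <= w k.+1 p.
Proof.
pose e (i : 'I_k.+1) : R := (i == ord0)%:R.
have e_simplex : simplex k.+1 e.
  split=> [i|]; first by rewrite ler0n.
  by rewrite (bigD1 ord0) //= big1 ?addr0 ?/e ?eqxx // => i /negbTE ->.
apply: le_trans (Pk_le_w_simplex e_simplex); rewrite PkE (bigD1 ord0) //= big1.
  rewrite addr0 /Pk_term /e eqxx powR1 mul1r big1 // => j /negbTE ->.
  by rewrite subr0 powR1.
by move=> i /negbTE i0; rewrite /Pk_term /e i0 powR0 ?mul0r // invr_neq0 ?gt_eqF.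
Qed.

Lemma Pk_le1_degenerate k (y : 'I_k -> R) i0 : (forall i, 0 <= y i <= 1) ->
  (forall i, i != i0 -> y i = 0 \/ y i0 = 1) -> Pk k p y <= 1.
Proof.
move=> y01 y_deg; have q_neq0 : p^-1 != 0 by rewrite invr_neq0 ?gt_eqF.
rewrite PkE (bigD1 i0) //= big1 ?addr0 ?Pk_term_le1 // => i /[dup] i_neq /y_deg [yi0|yi01].
  by rewrite /Pk_term yi0 powR0 ?mul0r.
by rewrite /Pk_term (bigD1 i0) 1?eq_sym //= yi01 subrr powR0 // mul0r mulr0.
Qed.

Definition simplex_rescale k t (y : 'I_k -> R) i := y i / (y i + t * (1 - y i)).

Lemma rescale_denom_gt0 (t a : R) : 0 < t -> 0 <= a < 1 -> 0 < a + t * (1 - a).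
Proof. by move=> t_gt0 /andP[a_ge0 a_lt1]; rewrite ltr_wpDl // mulr_gt0 ?subr_gt0. Qed.

Lemma continuous_sum_rescale k (y : 'I_k -> R) t : (forall i, 0 <= y i < 1) -> 0 < t ->
  {for t, continuous (fun s => \sum_i simplex_rescale s y i)}.
Proof.
move=> y01 t_gt0; apply: cvg_big => [|i _]; first exact: add_continuous.
rewrite /simplex_rescale.
apply: cvgM; first exact: cvg_cst.
apply: cvgV; first by rewrite gt_eqF ?rescale_denom_gt0.
exact: (cvgD (cvg_cst _) (cvgM cvg_id (cvg_cst _))).
Qed.

Lemma simplex_rescale_ge0 k (y : 'I_k -> R) t i :
  0 < t -> 0 <= y i < 1 -> 0 <= simplex_rescale t y i.
Proof.
move=> t_gt0 /[dup] y01 /andP[y_ge0 _].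
by rewrite divr_ge0 // ltW // rescale_denom_gt0.
Qed.

Lemma sum_rescale_ge1 k (y : 'I_k -> R) t a b : (forall i, 0 <= y i < 1) ->
  a != b -> 0 < t -> t <= y a -> t <= y b -> 1 <= \sum_i simplex_rescale t y i.
Proof.
move=> y01 ab t_gt0 t_le_ya t_le_yb.
have half i : t <= y i -> 1 / 2 <= simplex_rescale t y i.
  move=> t_le_yi; rewrite ler_pdivlMr ?rescale_denom_gt0 //.
  have /andP[y_ge0 y_lt1] := y01 i; have := mulr_ge0 (ltW t_gt0) y_ge0.
  lra.
rewrite (bigD1 a) //= (bigD1 b) 1?eq_sym //=.
have := half a t_le_ya; have := half b t_le_yb.
have : 0 <= \sum_(i | (i != a) && (i != b)) simplex_rescale t y i.
  by apply: sumr_ge0 => i _; apply: simplex_rescale_ge0.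
lra.
Qed.

Lemma sum_rescale_le1 k (y : 'I_k -> R) : (forall i, 0 <= y i < 1) ->
  \sum_i simplex_rescale (1 + \sum_i y i / (1 - y i)) y i <= 1.
Proof.
move=> y01; set r := \sum_i y i / (1 - y i); set t := 1 + r.
have r_ge0 : 0 <= r.
  by apply: sumr_ge0 => i _; case/andP: (y01 i) => ? ?; rewrite divr_ge0 // subr_ge0 ltW.
have t_gt0 : 0 < t by rewrite ltr_pwDl.
have term i : simplex_rescale t y i <= y i / (1 - y i) / t.
  have /andP[y_ge0 y_lt1] := y01 i.
  rewrite /simplex_rescale -mulrA -invfM ler_wpM2l // lef_pV2 ?posrE;
    rewrite ?rescale_denom_gt0 ?mulr_gt0 ?subr_gt0 //.
  by rewrite [_ * t]mulrC lerDr.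
apply: le_trans (ler_sum _ (fun i _ => term i)) _.
by rewrite -mulr_suml ler_pdivrMr // mul1r lerDr.
Qed.

Lemma exists_simplex_rescale k (y : 'I_k -> R) a b :
  (forall i, 0 <= y i < 1) -> a != b -> 0 < y a -> 0 < y b ->
  exists2 t, 0 < t & simplex k (simplex_rescale t y).
Proof.
move=> y01 ab ya_gt0 yb_gt0.
pose f t := \sum_i simplex_rescale t y i.
pose t0 := Num.min (y a) (y b); pose t1 := 1 + \sum_i y i / (1 - y i).
have t0_gt0 : 0 < t0 by rewrite lt_min ya_gt0 yb_gt0.
have t0_le_ya : t0 <= y a by rewrite ge_min lexx.
have t0_le_yb : t0 <= y b by rewrite ge_min lexx orbT.
have ft0 : 1 <= f t0 := sum_rescale_ge1 y01 ab t0_gt0 t0_le_ya t0_le_yb.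
have ft1 : f t1 <= 1 := sum_rescale_le1 y01.
have t01 : t0 <= t1.
  have /andP[_ ya_lt1] := y01 a; apply: le_trans t0_le_ya (le_trans (ltW ya_lt1) _).
  rewrite lerDl sumr_ge0 // => i _.
  by case/andP: (y01 i) => ? ?; rewrite divr_ge0 // subr_ge0 ltW.
have f_cont : {within `[t0, t1], continuous f}%classic.
  apply: continuous_in_subspaceT => t; rewrite inE /= in_itv /= => /andP[t0t _].
  exact: continuous_sum_rescale (lt_le_trans t0_gt0 t0t).
have [|t] := IVT t01 f_cont (v := 1); first by rewrite ge_min le_max ft1 ft0 orbT.
rewrite in_itv /= => /andP[t0t _] ft; have t_gt0 := lt_le_trans t0_gt0 t0t.
by exists t => //; split=> // i; apply: simplex_rescale_ge0.
Qed.

Lemma Pk_le_rescale k (y : 'I_k -> R) t : (forall i, 0 <= y i < 1) -> 0 < t ->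
  simplex k (simplex_rescale t y) -> Pk k p y <= Pk k p (simplex_rescale t y).
Proof.
move=> y01 t_gt0 x_simplex; set x := simplex_rescale t y.
have D_gt0 i : 0 < y i + t * (1 - y i) := rescale_denom_gt0 t_gt0 (y01 i).
have y_ge0 i : 0 <= y i by case/andP: (y01 i).
have y_compl_ge0 i : 0 <= 1 - y i by rewrite subr_ge0 ltW //; case/andP: (y01 i).
pose u i := t / (y i + t * (1 - y i)).
have u_ge0 i : 0 <= u i by rewrite divr_ge0 ?ltW.
have xE i : x i = y i * (u i / t) by rewrite /x /simplex_rescale /u; field; rewrite !gt_eqF.
have x1E i : 1 - x i = (1 - y i) * u i by rewrite /x /simplex_rescale /u; field; rewrite gt_eqF.
have uE i : u i = 1 + (t - 1) * x i by rewrite /x /simplex_rescale /u; field; rewrite gt_eqF.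
have t_le_prod_u : t <= \prod_i u i.
  have := weierstrass_ler_prod (index_enum 'I_k) (c := t - 1) _ (simplex_le1 x_simplex).
  case: x_simplex => _ ->; rewrite mulr1 [1 + _]addrC subrK; under eq_bigr do rewrite -uE.
  by apply; rewrite lerBrDr addNr ltW.
have prod_u_ge1 : 1 <= ((\prod_i u i) / t) `^ p^-1.
  have q_ge0 : 0 <= p^-1 by rewrite invr_ge0 ltW.
  have := ge0_ler_powR q_ge0 ler01 _ (_ : 1 <= (\prod_i u i) / t).
  rewrite powR1; apply; last by rewrite ler_pdivlMr // mul1r.
  by rewrite nnegrE divr_ge0 ?prodr_ge0 // ltW.
rewrite !PkE; apply: ler_sum => i _.
have -> : Pk_term x i = Pk_term y i * ((\prod_j u j) / t) `^ p^-1.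
  rewrite /Pk_term xE powRM ?divr_ge0 // ?ltW //.
  under eq_bigr do rewrite x1E powRM //.
  have prodE : \prod_j u j / t = u i / t * \prod_(j | j != i) u j.
    by rewrite (bigD1 i) //= mulrAC.
  rewrite big_split /= !powR_prod // prodE [in RHS]powRM ?divr_ge0 ?prodr_ge0 // ?ltW //.
  ring.
by rewrite ler_peMr ?Pk_term_ge0.
Qed.

Lemma Pk_le_w k (y : 'I_k.+1 -> R) : (forall i, 0 <= y i <= 1) -> Pk k.+1 p y <= w k.+1 p.
Proof.
move=> y01; have y_ge0 i : 0 <= y i by case/andP: (y01 i).
have Pk_le1_le_w i0 : (forall i, i != i0 -> y i = 0 \/ y i0 = 1) -> Pk k.+1 p y <= w k.+1 p.
  by move=> y_deg; apply: le_trans (Pk_le1_degenerate y01 y_deg) (w_ge1 k).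
case: (pickP (fun i => y i == 1)) => [i0 /eqP yi0 | y_neq1].
  by apply: (Pk_le1_le_w i0) => i _; right.
have y01_lt1 i : 0 <= y i < 1 by rewrite lt_neqAle y_neq1; case/andP: (y01 i) => -> ->.
case: (pickP (fun ab : 'I_k.+1 * 'I_k.+1 => [&& ab.1 != ab.2, 0 < y ab.1 & 0 < y ab.2])).
  move=> [a b] /and3P[ab ya yb].
  have [t t_gt0 x_simplex] := exists_simplex_rescale y01_lt1 ab ya yb.
  exact: le_trans (Pk_le_rescale y01_lt1 t_gt0 x_simplex) (Pk_le_w_simplex x_simplex).
move=> one_pos; have y_eq0 i : ~~ (0 < y i) -> y i = 0.
  by move=> yi; apply/eqP; move: yi; rewrite lt0r y_ge0 andbT negbK.
case: (pickP (fun a => 0 < y a)) => [a ya | y_npos].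
  apply: (Pk_le1_le_w a) => i ia; left; apply: y_eq0.
  by have := one_pos (i, a); rewrite /= ia ya andbT /= => ->.
by apply: (Pk_le1_le_w ord0) => i _; left; apply: y_eq0; rewrite y_npos.
Qed.

End SimplexPolynomial.

Lemma big_lift_neq (T : Type) (idx : T) (op : Monoid.com_law idx) m (F : 'I_m.+1 -> T) j :
  \big[op/idx]_(k | k != j) F k = \big[op/idx]_(i < m) F (lift j i).
Proof.
rewrite (reindex_omap (lift j) (unlift j)) /=.
  by apply: eq_bigl => i; rewrite liftK eq_sym neq_lift eqxx.
by move=> i; case: unliftP => [k ->|->]; rewrite ?eqxx.
Qed.

Lemma perm_mx_le_U_Pk (R : realType) (p : R) m (A : 'M[R]_m.+2) c : 0 < p ->
  rows_lp_unit p _ A -> Defs.perm_mx _ A <= U m.+1 p * Pk m.+2 p (fun j => `|A j c| `^ p).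
Proof.
move=> p_gt0 A1; rewrite (perm_mx_expand_col _ c) PkE mulr_sumr; apply: ler_sum => j _.
rewrite /Pk_term -powRrM mulfV ?gt_eqF // powRr1 //.
have -> : \prod_(k | k != j) (1 - `|A k c| `^ p) `^ p^-1 =
    \prod_i row_lpnorm p (col' c (row' j A)) i.
  rewrite big_lift_neq; apply: eq_bigr => i _; rewrite /row_lpnorm.
  under [in RHS]eq_bigr do rewrite !mxE.
  have := rows_lp_unit_sum p_gt0 A1 (lift j i); rewrite (bigD1_ord c) //= => <-.
  by rewrite addrAC subrr add0r.
rewrite mulrCA; apply: le_trans (ler_norm _) _; rewrite normrM ler_wpM2l //.
exact: perm_mx_le_U.
Qed.

Theorem mainTheorem6 (R : realType) (p : R) (n : nat) :
  1 <= p -> (2 <= n)%N -> U n p <= U n.-1 p * w n p.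
Proof.
move=> p_ge1; case: n => [|[|m]] // _ /=.
have p_gt0 : 0 < p := lt_le_trans ltr01 p_ge1.
apply: ge_sup => [|_ [A A1 <-]].
  by exists (Defs.perm_mx m.+2 1%:M), 1%:M => //; apply: rows_lp_unit_1.
apply: le_trans (perm_mx_le_U_Pk ord0 p_gt0 A1) _.
rewrite ler_wpM2l ?U_ge0 ?Pk_le_w // => j.
by rewrite powR_ge0 -(rows_lp_unit_sum p_gt0 A1 j) (bigD1 ord0) //= lerDl sumr_ge0.
Qed.
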